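(* Let $\mathcal{X}_\epsilon=\{x\in\mathbb{R}^n: d_{\complement\mathcal{X}}(x)\ge R+\epsilon\}$ be the practical free space, let $\kappa_0(x)\in\mathbb{R}^n$ be a nominal control input, and let $\psi$ be a $\mathcal{C}^l$-penalty scaling function with parameters $\mu,\nu>0$ (see context). With $s(x):=\kappa_0(x)^\top\eta(x)$, the solution to the unconstrained optimization problem $$\min_{u}\ \tfrac12\|u-\kappa_0(x)\|^2+\tfrac12\,\psi(d(x),s(x))\,(u^\top\eta(x))^2$$ is given by $$u=\hat\Pi(x)\kappa_0(x),$$ where the state-dependent projection matrix $\hat\Pi(x)\in\mathbb{R}^{n\times n}$ is defined as $$\hat\Pi(x)=\mathbf{I}_n-\frac{\psi(d(x),s(x))}{1+\psi(d(x),s(x))}\,\eta(x)\eta(x)^\top .$$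
   Context: Setting. $\mathcal{W}\subset\mathbb{R}^n$ is a workspace, $\mathcal{O}_1,\dots,\mathcal{O}_m\subset\mathcal{W}$ are closed sets (obstacles), and the free space is $\mathcal{X}:=\mathcal{W}\setminus\bigcup_{i=1}^m\mathbf{int}(\mathcal{O}_i)$. $\complement\mathcal{X}$ is the complement of $\mathcal{X}$ in $\mathbb{R}^n$ and $d_{\complement\mathcal{X}}(x)=\inf_{y\in\complement\mathcal{X}}\|y-x\|$. $R>0$ is the radius of a ball-shaped robot centred at $x$. Smoothness of the distance: there is $\rho>R$ such that $d_{\complement\mathcal{X}}$ is of class $\mathcal{C}^k$ on $\{x\in\mathcal{X}: R\le d_{\complement\mathcal{X}}(x)<\rho\}$. Uniqueness of projection: there is $h>R$ such that for all $x\in\mathcal{X}$ with $d_{\complement\mathcal{X}}(x)<h$ the nearest point to $x$ in $\partial\mathcal{X}$ is unique. The safety margin $\epsilon$ satisfies $0<\epsilon<\min(h,\rho)-R$. Notation: $d(x):=d_{\complement\mathcal{X}}(x)-(R+\epsilon)$ and $\eta(x):=\nabla d_{\complement\mathcal{X}}(x)$, a unit vector. A $\mathcal{C}^l$-penalty scaling function with parameters $\mu>0$ and $\nu>0$ is a function $\psi:\mathbb{R}\times\mathbb{R}\to\mathbb{R}_{\ge0}$ such that: (1) $\psi$ is of class $\mathcal{C}^l$ on $\mathbb{R}\times\mathbb{R}$; (2) $\psi(d,s)=0$ whenever $d\ge\mu$ or $s\ge\nu$; (3) $\psi(d,s)\to+\infty$ as $d\to0^-$ and $s\to0^-$ simultaneously.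 The parameter $\mu$ satisfies $0<\mu<\min(h,\rho)-(R+\epsilon)$. Where $d(x)\ge\mu$, the terms multiplied by $\psi(d(x),s(x))$ are zero.
   Formalization: The penalty scaling function ψ is required to be of class C^l only on ℝ×ℝ minus the origin, since a real-valued ψ continuous at (0,0) cannot tend to +∞ as d→0⁻ and s→0⁻; all its other conditions are unchanged. *)

(* Defs.v *)
From HB Require Import structures.
From mathcomp Require Import all_boot all_order all_algebra.
From mathcomp Require Import all_classical all_reals all_analysis.

Set Implicit Arguments.
Unset Strict Implicit.
Unset Printing Implicit Defensive.

Import Order.TTheory GRing.Theory Num.Theory.
Import numFieldNormedType.Exports.

Local Open Scope classical_set_scope.
Local Open Scope ring_scope.

Definition dotp {R : realType} {n : nat} (u v : 'cV[R]_n) : R :=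
  (u^T *m v) ord0 ord0.

(* The norm `|u| that MathComp-Analysis puts on matrices is the sup norm; it
   induces the same topology and notion of differentiability, but metric
   notions have to go through the Euclidean norm. *)
Definition enorm {R : realType} {n : nat} (u : 'cV[R]_n) : R :=
  Num.sqrt (dotp u u).

Definition gradient {R : realType} {n : nat} (f : 'cV[R]_n -> R)
    (x : 'cV[R]_n) : 'cV[R]_n :=
  \col_i 'D_(delta_mx i ord0) f x.

(* f is of class C^k on the open set U. For the finite-dimensional V used here
   ('cV[R]_n and R * R), the derivative of f is of class C^k if and only if
   all the directional derivatives 'D_v f are. *)
Fixpoint Ck_open {R : realType} {V : normedModType R} (k : nat) (U : set V)
    (f : V -> R) : Prop :=
  match k with
  | 0 => forall x, U x -> {for x, continuous f}
  | k'.+1 => (forall x, U x -> differentiable f x) /\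
             (forall v : V, Ck_open k' U ('D_v f))
  end.

(* For a set that need not be open, class C^k means the existence of a C^k
   extension to an open neighbourhood of the set. *)
Definition Ck_on {R : realType} {V : normedModType R} (k : nat) (A : set V)
    (f : V -> R) : Prop :=
  exists (U : set V) (g : V -> R),
    [/\ open U, A `<=` U, Ck_open k U g & forall x, A x -> f x = g x].

Definition boundary {T : topologicalType} (A : set T) : set T :=
  closure A `\` A°.

Definition nearest_points {R : realType} {n : nat} (A : set 'cV[R]_n)
    (x : 'cV[R]_n) : set 'cV[R]_n :=
  [set y | A y /\ forall z, A z -> enorm (y - x) <= enorm (z - x)].

(* Real-valued, hence meaningful for nonempty A only: inf set0 = 0. *)
Definition dist_to {R : realType} {n : nat} (A : set 'cV[R]_n)
    (x : 'cV[R]_n) : R :=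
  inf [set enorm (y - x) | y in A].

Definition free_space {R : realType} {n m : nat} (W : set 'cV[R]_n)
    (O : 'I_m -> set 'cV[R]_n) : set 'cV[R]_n :=
  W `\` \bigcup_i (O i)°.

Definition practical_free_space {R : realType} {n : nat} (X : set 'cV[R]_n)
    (r eps : R) : set 'cV[R]_n :=
  [set x | r + eps <= dist_to (~` X) x].

(* Penalty scaling functions of class C^l. A finite-valued function that
   satisfies psi_blowup cannot be continuous at the origin, so smoothness is
   required on the plane minus the origin: asking for it on the whole plane
   would leave no such function at all. *)
Record penalty_scaling {R : realType} (l : nat) (mu nu : R)
    (psi : R * R -> R) : Prop := PenaltyScaling {
  psi_ge0 : forall p, 0 <= psi p ;
  psi_smooth : Ck_open l (~` [set (0, 0)]) psi ;
  psi_eq0 : forall d s, (mu <= d) || (nu <= s) -> psi (d, s) = 0 ;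
  psi_blowup : psi p @[p --> filter_prod 0^'- 0^'-] --> +oo
}.

Section Control.
Context {R : realType} {n : nat} (X : set 'cV[R]_n) (r eps : R).
Context (psi : R * R -> R) (kappa0 : 'cV[R]_n -> 'cV[R]_n).

Definition margin (x : 'cV[R]_n) : R := dist_to (~` X) x - (r + eps).

(* Where the distance is not differentiable, eta has no meaning; this happens
   in the practical free space only if mu <= margin x, and then psi vanishes
   whatever its second argument is. *)
Definition eta : 'cV[R]_n -> 'cV[R]_n := gradient (dist_to (~` X)).

Definition align (x : 'cV[R]_n) : R := dotp (kappa0 x) (eta x).

Definition penalty (x : 'cV[R]_n) : R := psi (margin x, align x).

Definition cost (x u : 'cV[R]_n) : R :=
  1 / 2 * enorm (u - kappa0 x) ^+ 2 +
  1 / 2 * penalty x * dotp u (eta x) ^+ 2.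

Definition projection_mx (x : 'cV[R]_n) : 'M[R]_n :=
  1%:M - (penalty x / (1 + penalty x)) *: (eta x *m (eta x)^T).

End Control.

Definition minimizers {R : realType} {T : Type} (J : T -> R) : set T :=
  [set u | forall v, J u <= J v].

(* Main.v *)
(** The penalty vanishes wherever the margin is at least mu, and there both
    sides are kappa0 x. Where the margin is below mu, x is interior to the
    region on which the distance is smooth, so the distance is differentiable
    at x with a gradient eta of Euclidean norm 1: at most 1 because the
    distance is 1-Lipschitz, at least 1 because it decreases at unit rate
    towards almost nearest points. With |eta| = 1 the candidate is a stationary
    point of the cost, and completing the square shows that the cost exceeds
    its value there by at least half the squared distance to it. *)
Require Import Defs.
From HB Require Import structures.
From mathcomp Require Import all_boot all_order all_algebra.
From mathcomp Require Import all_classical all_reals all_analysis.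
From mathcomp Require Import ring lra.
Import Order.TTheory GRing.Theory Num.Theory.
Import numFieldNormedType.Exports.
Local Open Scope classical_set_scope.
Local Open Scope ring_scope.

(** * Euclidean inner product and norm, and their comparison with the sup norm *)

Section EuclideanSpace.
Context {R : realType} {n : nat}.
Implicit Types (u v w e : 'cV[R]_n) (a c : R).

Lemma dotpE u v : dotp u v = \sum_i u i ord0 * v i ord0.
Proof. by rewrite /dotp mxE; apply: eq_bigr => i _; rewrite mxE. Qed.

Lemma dotpC u v : dotp u v = dotp v u.
Proof. by rewrite !dotpE; apply: eq_bigr => i _; rewrite mulrC. Qed.

Lemma dotpDl u v w : dotp (u + v) w = dotp u w + dotp v w.
Proof. by rewrite /dotp linearD mulmxDl mxE. Qed.

Lemma dotpZl a u v : dotp (a *: u) v = a * dotp u v.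
Proof. by rewrite /dotp linearZ -scalemxAl mxE. Qed.

Lemma dotpNl u v : dotp (- u) v = - dotp u v.
Proof. by rewrite -scaleN1r dotpZl mulN1r. Qed.

Lemma dotpDr u v w : dotp u (v + w) = dotp u v + dotp u w.
Proof. by rewrite dotpC dotpDl !(dotpC u). Qed.

Lemma dotpZr a u v : dotp u (a *: v) = a * dotp u v.
Proof. by rewrite dotpC dotpZl (dotpC u). Qed.

Lemma dotpNr u v : dotp u (- v) = - dotp u v.
Proof. by rewrite dotpC dotpNl (dotpC u). Qed.

Definition dotp_linear := (dotpDl, dotpDr, dotpZl, dotpZr, dotpNl, dotpNr).

Lemma dotp_ge0 u : 0 <= dotp u u.
Proof. by rewrite dotpE sumr_ge0 // => i _; rewrite -expr2 sqr_ge0. Qed.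

Lemma sqr_coord_le_dotp u i : u i ord0 ^+ 2 <= dotp u u.
Proof.
rewrite dotpE (bigD1 i) //= -expr2 lerDl sumr_ge0 // => j _.
by rewrite -expr2 sqr_ge0.
Qed.

Lemma dotp_eq0 u : dotp u u = 0 -> u = 0.
Proof.
move=> u0; apply/matrixP => i j; rewrite ord1 mxE; apply/eqP.
by rewrite -sqrf_eq0 eq_le sqr_ge0 -u0 sqr_coord_le_dotp.
Qed.

Lemma enorm_ge0 u : 0 <= enorm u.
Proof. exact: sqrtr_ge0. Qed.

Lemma sqr_enorm u : enorm u ^+ 2 = dotp u u.
Proof. by rewrite sqr_sqrtr // dotp_ge0. Qed.

Lemma enorm0 : enorm (0 : 'cV[R]_n) = 0.
Proof. by rewrite /enorm -(scale0r 0) dotpZl mul0r sqrtr0. Qed.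

Lemma enormN u : enorm (- u) = enorm u.
Proof. by rewrite /enorm !dotp_linear opprK. Qed.

Lemma enormB u v : enorm (u - v) = enorm (v - u).
Proof. by rewrite -enormN opprB. Qed.

Lemma enormZ a u : enorm (a *: u) = `|a| * enorm u.
Proof.
by rewrite /enorm !dotp_linear mulrA -expr2 sqrtrM ?sqr_ge0// sqrtr_sqr.
Qed.

Lemma ler_dotp_enorm u v : dotp u v <= enorm u * enorm v.
Proof.
have [uv0|/ltW uv0] := leP (dotp u v) 0.
  by rewrite (le_trans uv0) // mulr_ge0 // enorm_ge0.
rewrite -ler_sqr ?nnegrE ?mulr_ge0 ?enorm_ge0// exprMn !sqr_enorm.
(* With [A], [B], [C] as named below, this square equals [C * (A * C - B ^+ 2)]; dividing by [C]
   requires [v] nonzero, whence the case split. *)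
have := dotp_ge0 (dotp v v *: u - dotp u v *: v).
have [v0 _|] := eqVneq (dotp v v) 0.
  rewrite v0 mulr0; move/dotp_eq0 : v0 => ->.
  by rewrite dotpC -(scale0r 0) dotpZl mul0r expr0n.
move=> v0; rewrite !dotp_linear (dotpC v u).
set A := dotp u u; set B := dotp u v; set C := dotp v v.
have C0 : 0 < C by rewrite lt_neqAle eq_sym v0 dotp_ge0.
rewrite -[_ <= A * C]subr_ge0 -(pmulr_rge0 _ C0); lra.
Qed.

Lemma ler_enormD u v : enorm (u + v) <= enorm u + enorm v.
Proof.
rewrite -ler_sqr ?nnegrE ?addr_ge0 ?enorm_ge0// sqrrD !sqr_enorm.
rewrite !dotp_linear (dotpC v u); have := ler_dotp_enorm u v; lra.
Qed.

Lemma mx_norm_le_enorm u : `|u| <= enorm u.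
Proof.
rewrite /Num.norm /= mx_normrE; apply/bigmax_leP; split; first exact: enorm_ge0.
move=> [i j] _ /=; rewrite ord1 -ler_sqr ?nnegrE ?enorm_ge0//.
by rewrite real_normK ?num_real// sqr_enorm sqr_coord_le_dotp.
Qed.

Lemma enorm_le_mx_norm u : enorm u <= Num.sqrt n%:R * `|u|.
Proof.
rewrite -[`|u|]ger0_norm // -sqrtr_sqr -sqrtrM ?ler0n//.
apply: ler_wsqrtr; rewrite dotpE -[n in n%:R]card_ord.
rewrite -sum1_card natr_sum mulr_suml; apply: ler_sum => i _.
rewrite mul1r -expr2 -[leLHS]real_normK ?num_real// lerXn2r ?nnegrE//.
rewrite [leRHS]/Num.norm /= mx_normrE.
exact: (le_bigmax _ (fun ij : 'I_n * 'I_1 => `|u ij.1 ij.2|) (i, ord0)).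
Qed.

(* Completing the square: the hypothesis on [c] is the stationarity of the
   penalized cost at [k - c <k, e> e]. *)
Lemma penalized_cost_sub (k e v : 'cV[R]_n) a c :
  c = a * (1 - c * dotp e e) ->
  let J w := 1 / 2 * enorm (w - k) ^+ 2 + 1 / 2 * a * dotp w e ^+ 2 in
  let u := k - (c * dotp k e) *: e in
  J v = J u + (1 / 2 * dotp (v - u) (v - u) + 1 / 2 * a * dotp (v - u) e ^+ 2).
Proof.
move=> hc J u; rewrite -{1}(subrK u v).
move: (v - u) => w; rewrite /J /u !sqr_enorm.
rewrite (_ : w + (k - (c * dotp k e) *: e) - k = w - (c * dotp k e) *: e);
  last by rewrite addrA addrAC addrK.
rewrite (_ : k - (c * dotp k e) *: e - k = - ((c * dotp k e) *: e));
  last by rewrite addrAC subrr add0r.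
rewrite !dotp_linear (dotpC e w).
move: (dotp w w) (dotp w e) (dotp k e) (dotp e e) hc => W P S E hc.
(* Only the cross terms in [w] survive in the difference; they carry the stationarity defect as a
   factor. *)
apply/subr0_eq; transitivity (S * P * (a * (1 - c * E) - c)); first by field.
by rewrite -hc subrr mulr0.
Qed.

End EuclideanSpace.

(** The first-order expansion of [f] at [x] is also one of [g]. This brings smoothness back from a
    local extension to the distance itself. *)
Lemma near_eq_differentiable {R : numFieldType} {V W : normedModType R}
    (f g : V -> W) (x : V) :
  (\forall z \near x, f z = g z) -> differentiable f x -> differentiable g x.
Proof.
move=> fg df; have fgx := nbhs_singleton fg.
have g_expansion : g \o shift x = cst (g x) + 'd f x +o_ 0 id.
  apply/eqaddoP => e e0.
  have /eqaddoP/(_ e e0) := diff_locally df.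
  have : \forall h \near 0, f (h + x) = g (h + x).
    have : (h + x) @[h --> (0 : V)] --> x.
      by rewrite -[X in _ --> X]add0r; apply: cvgD; [exact: cvg_id|exact: cvg_cst].
    by move/(_ _ fg).
  apply: filterS2 => h fgh /=.
  by rewrite !fctE /= fgh fgx.
apply/diff_locallyP; have dfc : continuous ('d f x) by apply: diff_continuous.
by rewrite (diff_unique dfc g_expansion).
Qed.

(** * Distance to a set and its gradient *)

Section GradientOfDistance.
Set Implicit Arguments.
Unset Strict Implicit.
Context {R : realType} {n : nat}.
Implicit Types (A : set 'cV[R]_n) (x y z : 'cV[R]_n).

Lemma differentiable_gradientE (f : 'cV[R]_n -> R) x v :
  differentiable f x -> 'd f x v = dotp (gradient f x) v.
Proof.
move=> df; rewrite {1}(matrix_sum_delta v) linear_sum dotpE.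
apply: eq_bigr => i _; rewrite big_ord1 linearZ /= mulrC.
by rewrite /gradient mxE deriveE.
Qed.

(** The differential is defined through the sup norm; as that norm is at most the Euclidean one,
    both the radius and the error bound carry over. *)
Lemma near_gradient_expansion (f : 'cV[R]_n -> R) x (e : R) :
  differentiable f x -> 0 < e ->
  exists2 t : R, 0 < t & forall v, enorm v < t ->
    `|f (v + x) - f x - dotp (gradient f x) v| <= e * enorm v.
Proof.
move=> df e0; have /eqaddoP/(_ e e0) := diff_locally df.
move=> /nbhs_normP[t /= t0 ht]; exists t => // v vt.
have := ht v; rewrite /ball_ /= sub0r normrN.
move=> /(_ (le_lt_trans (mx_norm_le_enorm v) vt)).
rewrite !fctE /= -differentiable_gradientE // opprD addrA => /le_trans; apply.
by rewrite ler_wpM2l ?mx_norm_le_enorm// ltW.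
Qed.

Let dist_set A x := [set enorm (y - x) | y in A].

Lemma has_lbound_dist_set A x : has_lbound (dist_set A x).
Proof. by exists 0 => _ [y _ <-]; exact: enorm_ge0. Qed.

Lemma dist_to_le A x y : A y -> dist_to A x <= enorm (y - x).
Proof. by move=> Ay; apply: ge_inf (has_lbound_dist_set A x) _ _; exists y. Qed.

Lemma dist_to_le0 A x : A x -> dist_to A x <= 0.
Proof. by move=> /(@dist_to_le _ x); rewrite subrr enorm0. Qed.

(** The infimum of the empty set is 0 by convention. *)
Lemma dist_to_gt0_nonempty A x : 0 < dist_to A x -> A !=set0.
Proof.
move=> d0; apply/set0P/eqP => A0; move: d0.
by rewrite /dist_to A0 image_set0 inf0 ltxx.
Qed.

Lemma dist_to_approx A x (e : R) : A !=set0 -> 0 < e ->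
  exists2 y, A y & enorm (y - x) < dist_to A x + e.
Proof.
move=> [z Az] e0; have hi : has_inf (dist_set A x).
  by split; [exists (enorm (z - x)), z | exact: has_lbound_dist_set].
by have [_ [y Ay <-] ye] := inf_adherent e0 hi; exists y.
Qed.

Lemma dist_to_lipschitz A x z :
  A !=set0 -> dist_to A z <= dist_to A x + enorm (z - x).
Proof.
move=> A0; apply/ler_addgt0Pr => e e0.
have [y Ay ye] := dist_to_approx x A0 e0.
apply: le_trans (dist_to_le z Ay) _.
rewrite -(subrK x y) -addrA; apply: le_trans (ler_enormD _ _) _.
by rewrite (enormB x) -addrA [_ + e]addrC addrA lerD2r ltW.
Qed.

Lemma continuous_dist_to A : A !=set0 -> continuous (dist_to A).
Proof.
move=> A0 x; apply/(@cvgrPdist_lt _ _ _ (nbhs x)) => e e0; rewrite near_simpl.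
(* The added 1 keeps this divisor positive even when [n] is 0. *)
have s0 : 0 < Num.sqrt n%:R + 1 :> R by rewrite ltr_wpDl ?sqrtr_ge0.
have : \forall z \near x, `|x - z| < e / (Num.sqrt n%:R + 1).
  by apply: (@cvgr_dist_lt R _ _ (nbhs x) _ id x (@cvg_id _ _)); rewrite divr_gt0.
apply: filterS => z; rewrite ltr_pdivlMr // => xz.
apply: le_lt_trans xz; apply: (@le_trans _ _ (enorm (x - z))).
  have := dist_to_lipschitz x z A0; have := dist_to_lipschitz z x A0.
  rewrite (enormB z) ler_norml; lra.
apply: le_trans (enorm_le_mx_norm _) _.
by rewrite mulrC ler_wpM2l // lerDl.
Qed.

(* No nearest point is needed: moving a distance [t] towards an almost nearest
   point decreases the distance by almost [t]. *)
Lemma gradient_dist_to_unit A x :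
  0 < dist_to A x -> differentiable (dist_to A) x ->
  dotp (gradient (dist_to A) x) (gradient (dist_to A) x) = 1.
Proof.
move=> d0 df; have A0 := dist_to_gt0_nonempty d0.
set g := gradient _ _; rewrite -sqr_enorm.
suff -> : enorm g = 1 by rewrite expr1n.
apply/eqP; rewrite eq_le; apply/andP; split; apply/ler_addgt0Pr => e e0.
- have [->|g0] := eqVneq (enorm g) 0; first by rewrite addr_ge0 // ltW.
  have {}g0 : 0 < enorm g by rewrite lt_neqAle eq_sym g0 enorm_ge0.
  have [t t0 ht] := near_gradient_expansion df e0.
  (* A step of length [t / 2] along [g]: the expansion gives a gain of at least [(enorm g - e)]
     times that length, the Lipschitz bound at most the length. *)
  pose a := t / 2 / enorm g.
  have a0 : 0 < a by rewrite !divr_gt0.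
  have ag : enorm (a *: g) = a * enorm g by rewrite enormZ gtr0_norm.
  have agt : a * enorm g < t by rewrite /a divfK ?gt_eqF //; lra.
  have := ht (a *: g); rewrite ag -/g dotpZr -sqr_enorm => /(_ agt).
  have := dist_to_lipschitz x (a *: g + x) A0; rewrite addrK ag.
  move=> hl; rewrite ler_norml => /andP[he _].
  by rewrite -(ler_pM2l (mulr_gt0 a0 g0)); lra.
- have e20 : 0 < e / 2 by lra.
  have [t t0 ht] := near_gradient_expansion df e20.
  (* The step [s] stays within the expansion radius and does not overshoot [y]. Half of the error
     [e * s] pays for [y] being only almost nearest, half for the expansion. *)
  pose s := Num.min (t / 2) (dist_to A x).
  have s0 : 0 < s by rewrite lt_min d0 andbT; lra.
  have st : s < t by rewrite gt_min; apply/orP; left; lra.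
  have sd : s <= dist_to A x by rewrite ge_min lexx orbT.
  have [y Ay ye] := dist_to_approx x A0 (mulr_gt0 e20 s0).
  have dy := dist_to_le x Ay.
  set l := enorm (y - x) in ye dy.
  have l0 : 0 < l by lra.
  pose v := (s / l) *: (y - x).
  have vs : enorm v = s.
    by rewrite enormZ gtr0_norm ?divr_gt0// divfK ?gt_eqF.
  have : dist_to A (v + x) <= l - s.
    apply: le_trans (dist_to_le _ Ay) _.
    have -> : y - (v + x) = (1 - s / l) *: (y - x).
      by rewrite scalerBl scale1r opprD addrCA addrC.
    rewrite enormZ ger0_norm; last first.
      by rewrite subr_ge0 ler_pdivrMr // mul1r; lra.
    by rewrite -/l mulrBl mul1r divfK ?gt_eqF.
  have := ht v; rewrite vs -/g => /(_ st); rewrite ler_norml => /andP[he _].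
  have := ler_dotp_enorm (- g) v; rewrite enormN vs dotpNl => hcs hd.
  by rewrite -(ler_pM2r s0); lra.
Qed.

End GradientOfDistance.

(** * Minimizers of the penalized cost *)

Theorem proposition1 (R : realType) (n m k l : nat)
    (W : set 'cV[R]_n) (O : 'I_m -> set 'cV[R]_n)
    (r h rho eps mu nu : R)
    (psi : R * R -> R) (kappa0 : 'cV[R]_n -> 'cV[R]_n)
    (O_closed : forall i, closed (O i))
    (O_sub : forall i, O i `<=` W)
    (r_gt0 : 0 < r)
    (k_gt0 : (0 < k)%N)
    (rho_gt : r < rho)
    (dist_smooth : let X := free_space W O in
      Ck_on k [set x | X x /\ r <= dist_to (~` X) x < rho] (dist_to (~` X)))
    (h_gt : r < h)
    (proj_unique : let X := free_space W O in
      forall x, X x -> dist_to (~` X) x < h ->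
        exists! y, nearest_points (boundary X) x y)
    (eps_bounds : 0 < eps < Num.min h rho - r)
    (mu_bounds : 0 < mu < Num.min h rho - (r + eps))
    (nu_gt0 : 0 < nu)
    (psi_penalty : penalty_scaling l mu nu psi) :
  let X := free_space W O in
  forall x, practical_free_space X r eps x ->
    minimizers (cost X r eps psi kappa0 x) =
    [set projection_mx X r eps psi kappa0 x *m kappa0 x].
Proof.
move=> X x; rewrite /practical_free_space /= => xe.
have [[U [g [oU AU gk gE]]] psi0] := (dist_smooth, psi_ge0 psi_penalty).
have /andP[eps0 epsh] := eps_bounds.
have /andP[mu0 muh] := mu_bounds.
have d0 : 0 < dist_to (~` X) x by lra.
have C0 := dist_to_gt0_nonempty d0.
set a := penalty X r eps psi kappa0 x.
set e := Defs.eta X x.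
have a0 : 0 <= a by exact: psi0.
have ae : a = 0 \/ dotp e e = 1.
  have [mux|xmu] := leP mu (margin X r eps x).
    by left; apply: psi_eq0 psi_penalty _ _ _; rewrite mux.
  right; apply: gradient_dist_to_unit => //.
  (* At [x] both bounds are strict, by [0 < eps] and by the upper bound on [mu], so they persist
     nearby by continuity; points outside [X] have distance at most 0. *)
  have xA : \forall z \near x, X z /\ r <= dist_to (~` X) z < rho.
    have dc : {for x, continuous (dist_to (~` X))} by exact: continuous_dist_to.
    have dr : r < dist_to (~` X) x by lra.
    have drho : dist_to (~` X) x < rho.
      have : Num.min h rho <= rho by rewrite ge_min lexx orbT.
      move: xmu; rewrite /margin; lra.
    have nr : \forall z \near x, r < dist_to (~` X) z by exact: (cvgr_gt _ dc).
    have nrho : \forall z \near x, dist_to (~` X) z < rho.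
      by exact: (cvgr_lt _ dc).
    move: nr nrho; apply: filterS2 => z rz zrho.
    split; last by rewrite ltW.
    by apply: contrapT => Xz; have := @dist_to_le0 _ _ (~` X) z Xz; lra.
  have dg : differentiable g x.
    move: gk; rewrite -(prednK k_gt0) => -[dg _]; apply: dg.
    exact/AU/(nbhs_singleton xA).
  apply: near_eq_differentiable dg.
  by apply: filterS xA => z zA; apply/esym/gE.
(* Stationarity for [c = a / (1 + a)]: both sides are 0 if [a = 0], and [1 - c = 1 / (1 + a)]
   settles the unit case. *)
have hc : a / (1 + a) = a * (1 - a / (1 + a) * dotp e e).
  by case: ae => ->; [rewrite !mul0r | field; lra].
have -> : projection_mx X r eps psi kappa0 x *m kappa0 x =
    kappa0 x - (a / (1 + a) * dotp (kappa0 x) e) *: e.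
  rewrite /projection_mx -/a -/e mulmxBl mul1mx -scalemxAl -mulmxA.
  by rewrite (mx11_scalar (e^T *m _)) mul_mx_scalar scalerA [dotp _ e]dotpC.
have J := penalized_cost_sub (kappa0 x) e _ a _ hc.
apply/seteqP; split=> [u umin|_ -> v]; last first.
  rewrite /cost -/a -/e (J v) lerDl addr_ge0 //.
    by rewrite mulr_ge0 ?dotp_ge0//; lra.
  by rewrite mulr_ge0 ?sqr_ge0//; lra.
(* Uniqueness: a minimizer has no excess cost over the candidate, while the excess is a sum of two
   nonnegative terms, one being half the squared distance. *)
apply/subr0_eq/dotp_eq0.
have := umin (kappa0 x - (a / (1 + a) * dotp (kappa0 x) e) *: e).
rewrite /cost -/a -/e (J u); set w := u - _ => hw.
have w0 := dotp_ge0 w.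
have := mulr_ge0 a0 (sqr_ge0 (dotp w e)) => aw0.
by apply/eqP; rewrite eq_le w0 andbT; lra.
Qed.
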